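(* Let $G$ be a finite abelian group of type $(m_1,\dots,m_r)$ and rank $r$. For every subset $A\subseteq G$ the following are equivalent: (i) $\operatorname{diam}^+_A(G)=\operatorname{diam}^+(G)$; (ii) there exists a standard generating set $\{e_1,\dots,e_r\}$ for $G$ such that one can write $A_0=A\cup\{0\}=\{0,a_1,\dots,a_r\}$ so that for each $i\in[1,r]$, either $a_i=e_i$, or $a_i=e_i+a_{\sigma(i)}$ for some $\sigma(i)\in[i+1,r]$. Moreover, if $A$ is as in (ii), then every $g\in G$ can be written uniquely as $g=\sum_{i=1}^r\lambda_i a_i$ with $\lambda_i\in[0,m_i-1]$ for all $i$, and for this representation $l^+_A(g)=\sum_{i=1}^r\lambda_i$.
   Context: Groups are written additively; $[x,y]$ denotes the set of integers $n$ with $x\le n\le y$. A finite abelian group $G$ has type $(m_1,\dots,m_r)$ if $G\cong \mathbb{Z}_{m_1}\oplus\dots\oplus\mathbb{Z}_{m_r}$ with $1\neq m_1\mid\dots\mid m_r$; $r$ is the rank. A standard generating set for $G$ is an ordered subset $\{a_1,\dots,a_r\}\subseteq G$ with $G=\langle a_1\rangle\oplus\dots\oplus\langle a_r\rangle$ and $\operatorname{ord}(a_i)=m_i$ for all $i$. For $A\subseteq G$ let $A_0:=A\cup\{0\}$ and $\langle A\rangle^+_\rho:=\rho A_0=\{a_1+\dots+a_\rho: a_i\in A_0\}$ for $\rho\in\mathbb{N}_0$. The length of $g\in G$ is $l^+_A(g):=\min\{\rho\in\mathbb{N}_0: g\in\langle A\rangle^+_\rho\}$ ($\min\varnothing=\infty$).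 $\operatorname{diam}^+_A(G):=\min\{\rho\in\mathbb{N}_0:\langle A\rangle^+_\rho=G\}$, and $\operatorname{diam}^+(G):=\max\{\operatorname{diam}^+_A(G): \langle A\rangle=G\}$. *)

(* Defs.v *)
From HB Require Import structures.
From mathcomp Require Import all_boot all_order all_algebra all_fingroup all_solvable.
Set Implicit Arguments. Unset Strict Implicit. Unset Printing Implicit Defensive.
Import GRing.Theory.
Local Open Scope ring_scope.

(* A finite abelian group written additively is a [finZmodType]; it carries the
   canonical finGroupType structure with group law +, so #[x]%g is the order
   of x, <[x]>%g the cyclic subgroup, <<A>>%g the generated subgroup and
   dprod the internal direct product. *)

Section Defs.
Variable G : finZmodType.

Definition A0 (A : {set G}) : {set G} := A :|: [set 0].

Definition sumset (A : {set G}) (rho : nat) : {set G} :=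
  [set g | [exists f : {ffun 'I_rho -> G},
             [forall i, f i \in A0 A] && (g == \sum_(i < rho) f i)]].

Definition length_is (A : {set G}) (g : G) (n : nat) : Prop :=
  g \in sumset A n /\ forall k, g \in sumset A k -> (n <= k)%N.

Definition diamA_is (A : {set G}) (d : nat) : Prop :=
  sumset A d = [set: G] /\ forall k, sumset A k = [set: G] -> (d <= k)%N.

Definition diam_is (d : nat) : Prop :=
  (exists A : {set G}, <<A>>%g = [set: G] /\ diamA_is A d) /\
  (forall (A : {set G}) (d' : nat), <<A>>%g = [set: G] -> diamA_is A d' -> (d' <= d)%N).

Definition std_gen (r : nat) (m : 'I_r -> nat) (e : 'I_r -> G) : Prop :=
  (\big[dprod/1%g]_(i < r) <[e i]>%g = [set: G]) /\ (forall i, #[e i]%g = m i).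

Definition special_form (r : nat) (A : {set G}) (e a : 'I_r -> G) : Prop :=
  A0 A = 0 |: [set a i | i : 'I_r] /\
  (forall i : 'I_r, a i = e i \/ exists j : 'I_r, (i < j)%N /\ a i = e i + a j).

End Defs.

(* Main.v *)
Require Import Defs.
From HB Require Import structures.
From mathcomp Require Import all_boot all_order all_algebra all_fingroup all_solvable.
From mathcomp Require Import zify.
Set Implicit Arguments. Unset Strict Implicit. Unset Printing Implicit Defensive.
Import GRing.Theory FinRing.Theory.

(**
For a subgroup K let w(K) be the sum of m - 1 over the invariants m of G/K.
If e is the exponent of G/K and y has order e mod K, then w(K) = e - 1 + w(K + <y>).
For an arbitrary a one picks y of maximal order both mod K and mod K + <a>; induction on
G/K then gives  ord_K(a) - 1 + w(K + <a>) <= w(K),  where equality forces ord_K(a), or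
else the exponent of G / (K + <a>), to be e.  Adjoining the elements of A one at a time
yields diam_A <= w(0) = sum (m_i - 1), and if the diameter equals w(0) then A contains at
each stage an element of maximal order modulo the span of the previous ones: this produces
a_r, ..., a_1 in A such that a_i has order m_i modulo H_(i+1) = <a_(i+1), ..., a_r>.

Lifting through the cyclic factors shows m_i a_i \in m_i H_(i+1).  Since the diameter is
w(0), the element sum (m_i - 1) a_i has length w(0), hence every combination of the a_i
with coefficients below m_i is shortest.  Applied to the elements of A, this shows that A
has no nonzero element besides the a_i; applied to m_i a_i = sum_(j > i) c_j a_j with
m_i | c_j and c_j < m_j, it gives sum c_j <= m_i, so that m_i a_i is 0 or some m_i a_j.
Then e_i is a_i or a_i - a_j accordingly.
*)

(** * Invariants of finite abelian groups *)

(** In a divisor chain the head has the largest valuation at every prime, so the counts determine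
    the head, which is then cancelled. *)
Lemma eq_dvdn_sorted_count (s t : seq nat) :
    sorted [rel m n | n %| m] s -> sorted [rel m n | n %| m] t ->
    all (ltn 1) s -> all (ltn 1) t ->
    (forall p n, count [pred m | n < logn p m] s = count [pred m | n < logn p m] t) ->
  s = t.
Proof.
have hd (u v : seq nat) m k : sorted [rel m n | n %| m] (m :: u) ->
    sorted [rel m n | n %| m] (k :: v) -> 1 < m -> 1 < k ->
    (forall p n, count [pred m | n < logn p m] (m :: u) =
                 count [pred m | n < logn p m] (k :: v)) ->
    k %| m.
  move=> su sv m1 k1 eq_c; apply/dvdn_partP; first exact: ltnW.
  move=> p pk; rewrite p_part pfactor_dvdn ?(ltnW m1) //; last first.
    by move: pk; rewrite mem_primes => /andP[].
  rewrite leqNgt; apply/negP => lt_mk.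
  (* At the threshold [logn p m] the chain of [m] counts 0, as all its terms divide [m], while [k]
     makes the other count positive. *)
  have := eq_c p (logn p m); rewrite /= lt_mk ltnn add0n add1n.
  suff /eqP -> : count [pred m0 | logn p m < logn p m0] u == 0 by [].
  rewrite -leqn0 leqNgt -has_count; apply/hasPn => x ux /=; rewrite -leqNgt.
  apply: dvdn_leq_log; first exact: ltnW.
  have tr : transitive [rel m n : nat | n %| m].
    by move=> a b c /= ba cb; apply: dvdn_trans cb ba.
  by move: su; rewrite /= (path_sortedE tr) => /andP[/allP/(_ _ ux)].
elim: s t => [|m s IHs] [|k t] //= ss st.
- move=> _ /andP[k1 _] /(_ (pdiv k) 0).
  by rewrite logn_gt0 pi_pdiv k1.
- move=> /andP[m1 _] _ /(_ (pdiv m) 0).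
  by rewrite logn_gt0 pi_pdiv m1.
move=> /andP[m1 s1] /andP[k1 t1] eq_c.
have eq_mk : m = k.
  apply/eqP; rewrite eqn_dvd; apply/andP; split; last exact: (hd s t).
  by apply: (hd t s) => // p n; apply/esym/eq_c.
move: eq_c; rewrite -eq_mk => eq_c; congr cons; apply: IHs => //.
- exact: path_sorted ss.
- exact: path_sorted st.
by move=> p n; apply/eqP; rewrite -(eqn_add2l (n < logn p m)) eq_c.
Qed.

Section AbelianType.
Local Open Scope group_scope.
Variable gT : finGroupType.
Implicit Types G : {group gT}.

(** For each [p] and [n], the number of cyclic factors whose order has valuation above [n] at [p]
    depends only on [G]. *)
Lemma abelian_type_unique b G :
    \big[dprod/1]_(x <- b) <[x]> = G ->
    sorted [rel m n | n %| m] (map order b) -> all (ltn 1%N) (map order b) ->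
  map order b = abelian_type G.
Proof.
move=> defG sb b1.
have cGG : abelian G.
  elim: b G defG {sb b1} => [|x b IHb] G; first by rewrite big_nil => <-; apply: abelian1.
  rewrite big_cons; case/dprodP=> [[_ H _ defH]] <-; rewrite defH => cxH _.
  by rewrite abelianM cycle_abelian IHb.
have [c defGc oc] := abelian_structure cGG.
rewrite -oc; apply: eq_dvdn_sorted_count => //.
- by rewrite oc abelian_type_dvdn_sorted.
- by rewrite oc; apply: abelian_type_gt1.
move=> p n; rewrite !count_map.
by rewrite (count_logn_dprod_cycle p n defG) (count_logn_dprod_cycle p n defGc).
Qed.

(** A cyclic subgroup whose order is the exponent splits off. Its complement is isomorphic to the
    quotient, and [#[y]] is a multiple of the remaining invariants. *)
Lemma abelian_type_max_order G y :
    abelian G -> G :!=: 1 -> y \in G -> #[y] = exponent G ->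
  abelian_type G = #[y] :: abelian_type (G / <[y]>).
Proof.
move=> cGG ntG Gy oy.
have /splitsP[H /complP[tiyH defG]] := abelian_splits Gy oy cGG.
have sHG : H \subset G by rewrite -defG mulG_subr.
have cyH : H \subset 'C(<[y]>).
  by apply: (sub_abelian_cent2 cGG); rewrite // cycle_subG.
have dG : <[y]> \x H = G by rewrite dprodE.
have [b defH ob] := abelian_structure (abelianS sHG cGG).
have isoH : H \isog G / <[y]>.
  have -> : G / <[y]> = H / <[y]> by rewrite -defG quotientMidl.
  by rewrite quotient_isog ?cents_norm // setIC.
rewrite -(isog_abelian_type isoH) -ob -(@abelian_type_unique (y :: b) G) //.
- by rewrite big_cons defH.
- have := abelian_type_dvdn_sorted H; rewrite -ob /=.
  case: b defH ob => //= x b defH ob ->; rewrite andbT oy dvdn_exponent //.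
  apply: (subsetP sHG); rewrite -(bigdprodWY defH) mem_gen // big_cons inE.
  by rewrite cycle_id.
rewrite /= ob; apply/andP; split; last exact: abelian_type_gt1.
by rewrite oy ltn_neqAle exponent_gt0 eq_sym -dvdn1 -trivg_exponent ntG.
Qed.

End AbelianType.

(** Of two pairs with equal product, the one containing the largest factor [e] has the larger sum:
    e(e + n' - n - e') = (e - n)(e - e'). It serves to compare the orders of two elements modulo K
    with their orders modulo K extended by the other one. *)
Lemma leq_cross_add n n' e e' :
    n * e' = e * n' -> n < e -> e' <= e ->
  n + e' <= e + n' /\ (n + e' = e + n' -> e' = e).
Proof.
move=> eq_c lt_n le_e'.
have [u def_e] : exists u, e = (n + u)%N by exists (e - n)%N; lia.
have [v def_e'] : exists v, e = (e' + v)%N by exists (e - e')%N; lia.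
have key : (e * (n + e') + u * v = e * (e + n'))%N.
  by rewrite [(e * (e + _))%N]mulnDr -eq_c {2}def_e' def_e; lia.
split=> [|eq_s].
  by rewrite -(@leq_pmul2l e) ?(leq_ltn_trans _ lt_n) // -key leq_addr.
have /eqP : (u * v = 0)%N by move: key; rewrite eq_s; lia.
by rewrite muln_eq0; lia.
Qed.

Lemma dvdn_div_logn p d e : (0 < e)%N -> prime p -> d %| e -> (logn p d < logn p e)%N ->
  d %| e %/ p.
Proof.
move=> e0 pp de lt_de; have pe : p %| e.
  by move: lt_de; case: (posnP (logn p e)) => [->//|]; rewrite logn_gt0 mem_primes => /and3P[].
have /dvdnP[k def_e] := de.
have d0 : (0 < d)%N by apply: dvdn_gt0 de.
have k0 : (0 < k)%N by move: e0; rewrite def_e muln_gt0 => /andP[].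
move: lt_de; rewrite def_e lognM // -[X in (X < _)%N]add0n ltn_add2r logn_gt0.
rewrite mem_primes => /and3P[_ _ /dvdnP[q ->]].
by rewrite mulnAC mulnK ?prime_gt0 // dvdn_mull.
Qed.

(** * Elements of maximal order in quotients *)

Section Quotients.
Local Open Scope group_scope.
Variable gT : finGroupType.
Implicit Types (G K L : {group gT}) (A : {set gT}).

Definition type_weight G A := (\sum_(m <- abelian_type (G / A)) m.-1)%N.

Lemma exponent_quotient_witness G K :
  abelian G -> {y | y \in G & #[coset K y] = exponent (G / K)}.
Proof.
move=> cGG; have [z] := exponent_witness (abelian_nil (quotient_abelian K cGG)).
move=> Gz /esym oz; pose P y := (y \in G) && (coset K y == z).
have exP : exists y, P y.
  by case/morphimP: Gz => y _ Gy def_z; exists y; rewrite /P Gy def_z eqxx.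
by exists (xchoose exP); have /andP[? /eqP eq_z] := xchooseP exP; rewrite ?eq_z.
Qed.

Lemma dvdn_order_coset G K x : x \in G -> #[coset K x] %| exponent (G / K).
Proof. by move=> Gx; apply/dvdn_exponent/mem_quotient. Qed.

(** Otherwise e/p, with e the exponent, would kill both [x * y] and [y] modulo [K], hence also [x],
    against the full valuation of its order at [p]. *)
Lemma logn_order_mulg G K p x y :
    abelian G -> K \subset G -> prime p -> x \in G -> y \in G ->
    logn p #[coset K x] = logn p (exponent (G / K)) ->
    (logn p #[coset K y] < logn p (exponent (G / K)))%N ->
  logn p #[coset K (x * y)] = logn p (exponent (G / K)).
Proof.
move=> cGG sKG pp Gx Gy ox oy; set e := exponent _ in ox oy *.
have nKG : G \subset 'N(K) by apply: sub_abelian_norm.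
have e0 : (0 < e)%N by apply: exponent_gt0.
have Gxy : x * y \in G by rewrite groupM.
have pe : p %| e.
  by case: (posnP (logn p e)) oy => [->//|]; rewrite logn_gt0 mem_primes => /and3P[].
apply/eqP; rewrite eqn_leq dvdn_leq_log ?dvdn_order_coset //= leqNgt; apply/negP => lt.
have := dvdn_div_logn e0 pp (dvdn_order_coset K Gxy) lt.
have := dvdn_div_logn e0 pp (dvdn_order_coset K Gy) oy.
rewrite !order_dvdn => /eqP y1 /eqP.
rewrite morphM ?(subsetP nKG) // expgMn; last first.
  by apply: (centsP (quotient_abelian K cGG)); apply: mem_quotient.
rewrite y1 mulg1 => /eqP; rewrite -order_dvdn => /dvdn_leq_log -/(_ p).
rewrite ox divn_gt0 ?prime_gt0 // (dvdn_leq e0 pe) => /(_ isT).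
have [q def_q] := dvdnP pe; have q0 : (0 < q)%N by move: e0; rewrite def_q muln_gt0 => /andP[].
rewrite def_q mulnK ?prime_gt0 // lognM ?(prime_gt0 pp) //.
by rewrite (logn_prime p pp) eqxx addn1 ltnn.
Qed.

(* The elements failing to have maximal order mod K at p form a proper subgroup, as do
   those for L, and a group is not the union of two proper subgroups. *)
Lemma max_order2_p G K L p :
    abelian G -> K \subset G -> L \subset G -> prime p ->
  exists2 y, y \in G & logn p #[coset K y] = logn p (exponent (G / K)) /\
    logn p #[coset L y] = logn p (exponent (G / L)).
Proof.
move=> cGG sKG sLG pp.
have [x Gx ox] := exponent_quotient_witness K cGG.
have [y Gy oy] := exponent_quotient_witness L cGG.
have leK z : z \in G -> (logn p #[coset K z] <= logn p (exponent (G / K)))%N.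
  by move=> Gz; rewrite dvdn_leq_log ?exponent_gt0 ?dvdn_order_coset.
have leL z : z \in G -> (logn p #[coset L z] <= logn p (exponent (G / L)))%N.
  by move=> Gz; rewrite dvdn_leq_log ?exponent_gt0 ?dvdn_order_coset.
have := leL x Gx; rewrite leq_eqVlt => /orP[/eqP eq_x|lt_x]; first by exists x; rewrite ?ox.
have := leK y Gy; rewrite leq_eqVlt => /orP[/eqP eq_y|lt_y]; first by exists y; rewrite ?oy.
exists (x * y); first exact: groupM.
split; first by apply: logn_order_mulg; rewrite // ox.
have cxy : x * y = y * x by apply: (centsP cGG).
by rewrite cxy; apply: logn_order_mulg; rewrite // oy.
Qed.

(** Elements that are good at a single prime are glued from their primary constituents. *)
Lemma max_order2 G K L :
    abelian G -> K \subset G -> L \subset G ->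
  exists2 y, y \in G & #[coset K y] = exponent (G / K) /\ #[coset L y] = exponent (G / L).
Proof.
move=> cGG sKG sLG.
(* The primes below [n] are treated in turn; once [n] exceeds both exponents, every relevant prime
   is covered. *)
suff H n : exists2 y, y \in G & forall p, (p < n)%N -> prime p ->
    logn p #[coset K y] = logn p (exponent (G / K)) /\
    logn p #[coset L y] = logn p (exponent (G / L)).
  have [y Gy Hy] := H (maxn (exponent (G / K)) (exponent (G / L))).+1; exists y => //.
  have max (M : {group gT}) : (exponent (G / M) <= maxn (exponent (G / K)) (exponent (G / L)))%N ->
      (forall p, (p < (maxn (exponent (G / K)) (exponent (G / L))).+1)%N -> prime p ->
       logn p #[coset M y] = logn p (exponent (G / M))) ->
      #[coset M y] = exponent (G / M).
    move=> leM HM; apply/eqP; rewrite eqn_dvd dvdn_order_coset //=.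
    apply/dvdn_partP => [|p]; first exact: exponent_gt0.
    rewrite mem_primes => /and3P[pp e0 pe].
    rewrite p_part pfactor_dvdn // HM // ltnS (leq_trans _ leM) //.
    exact: dvdn_leq e0 pe.
  by split; apply: max => [|p ltp pp]; rewrite ?leq_maxl ?leq_maxr //;
     have [] := Hy p ltp pp.
elim: n => [|n [y Gy IHy]]; first by exists 1.
have [pn|npn] := boolP (prime n); last first.
  exists y => // p; rewrite ltnS leq_eqVlt => /orP[/eqP ->|]; last exact: IHy.
  by rewrite (negPf npn).
have [w Gw [wK wL]] := max_order2_p cGG sKG sLG pn.
have Gy' : y.`_n^' \in G by rewrite groupX.
have Gw' : w.`_n \in G by rewrite groupX.
(* The corrected element takes its valuation at [n] from [w] and at any other prime from [y]. *)
have ord (M : {group gT}) p : M \subset G -> prime p ->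
    logn p #[coset M (y.`_n^' * w.`_n)] =
    logn p (if p == n then #[coset M w] else #[coset M y]).
  move=> sMG pp; have nMG : G \subset 'N(M) by apply: sub_abelian_norm.
  rewrite -[LHS]logn_part -order_constt morphM ?(subsetP nMG) // consttM; last first.
    by apply: (centsP (quotient_abelian M cGG)); apply: mem_quotient.
  rewrite !morph_constt ?(subsetP nMG) //.
  have p_w : (coset M w).`_n.`_p = if p == n then (coset M w).`_p else 1.
    case: eqP => [->|np]; first by rewrite constt_p_elt ?p_elt_constt.
    apply/constt1P; apply: (sub_p_elt _ (p_elt_constt n _)) => q.
    by rewrite !inE => /eqP ->; rewrite eq_sym; apply/eqP.
  have p_y : (coset M y).`_n^'.`_p = if p == n then 1 else (coset M y).`_p.
    case: eqP => [->|np]; first by apply/constt1P/p_elt_constt.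
    by rewrite sub_in_constt // => q _; rewrite !inE => /eqP ->; apply/eqP.
  rewrite p_w p_y; case: (p == n); rewrite ?mulg1 ?mul1g order_constt logn_part //.
exists (y.`_n^' * w.`_n) => [|p]; first exact: groupM.
rewrite ltnS => ltp pp; rewrite !ord //.
case: eqP ltp => [->|/eqP np ltp]; first by [].
by apply: IHy => //; rewrite ltn_neqAle np.
Qed.

Lemma order_coset_dvdn G K x n :
  abelian G -> K \subset G -> x \in G -> (#[coset K x] %| n) = (x ^+ n \in K).
Proof.
move=> cGG sKG Gx; have nKG := subsetP (sub_abelian_norm cGG sKG).
rewrite order_dvdn -morphX ?nKG //; apply/eqP/idP => [|/coset_id //].
by move/coset_idr; apply; rewrite groupX ?nKG.
Qed.

Lemma order_coset_subset G K L x :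
    abelian G -> K \subset L -> L \subset G -> x \in G ->
  #[coset L x] %| #[coset K x].
Proof.
move=> cGG sKL sLG Gx; rewrite (order_coset_dvdn _ cGG) // (subsetP sKL) //.
by rewrite -(order_coset_dvdn _ cGG) ?(subset_trans sKL).
Qed.

Lemma quotient_joing_cycle G K a :
    abelian G -> K \subset G -> a \in G ->
  (K <*> <[a]>) / K = <[coset K a]>.
Proof.
move=> cGG sKG Ga; have nKG : G \subset 'N(K) by apply: sub_abelian_norm.
rewrite joingC quotientYidr ?quotient_cycle ?cycle_subG ?(subsetP nKG) //.
Qed.

Lemma joing_cycle_sub G K a : K \subset G -> a \in G -> K <*> <[a]> \subset G.
Proof. by move=> sKG Ga; rewrite join_subG sKG cycle_subG. Qed.

Lemma card_joing_cycle G K a :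
    abelian G -> K \subset G -> a \in G ->
  #|K <*> <[a]>| = (#|K| * #[coset K a])%N.
Proof.
move=> cGG sKG Ga; rewrite orderE -(quotient_joing_cycle cGG) //.
have nK : K <*> <[a]> \subset 'N(K).
  by apply: subset_trans (sub_abelian_norm cGG sKG); apply: joing_cycle_sub.
by rewrite card_quotient // Lagrange // joing_subl.
Qed.

Lemma abelian_type_quotient_max G K y :
    abelian G -> K \proper G -> y \in G -> #[coset K y] = exponent (G / K) ->
  abelian_type (G / K) = #[coset K y] :: abelian_type (G / (K <*> <[y]>)).
Proof.
move=> cGG ltKG Gy oy; have sKG := proper_sub ltKG.
have nKG : G \subset 'N(K) by apply: sub_abelian_norm.
have sKyG := joing_cycle_sub sKG Gy.
rewrite [LHS](@abelian_type_max_order _ _ (coset K y)) ?quotient_abelian ?mem_quotient //; last first.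
  by rewrite -subG1 quotient_sub1 // proper_subn.
congr cons; rewrite -(quotient_joing_cycle cGG) //; apply: isog_abelian_type.
by apply: third_isog; rewrite ?joing_subl // -sub_abelian_normal // (abelianS _ cGG).
Qed.

Lemma type_weight_max G K y :
    abelian G -> K \subset G -> y \in G -> #[coset K y] = exponent (G / K) ->
  type_weight G K = (#[coset K y].-1 + type_weight G (K <*> <[y]>))%N.
Proof.
move=> cGG sKG Gy oy; have [eqKG|ltKG] := eqVproper sKG; last first.
  by rewrite /type_weight (abelian_type_quotient_max cGG ltKG Gy oy) big_cons.
have -> : K <*> <[y]> = K by apply/joing_idPl; rewrite cycle_subG eqKG.
by rewrite oy eqKG trivg_quotient exponent1.
Qed.

(** With [y] of maximal order modulo both [K] and K + <a>, the two weights split off the orders e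
    and e' of [y]; the induction hypothesis for K + <y> then reduces the claim to
    [leq_cross_add]. *)
Lemma type_weight_cycle G K a :
    abelian G -> K \subset G -> a \in G ->
  (#[coset K a].-1 + type_weight G (K <*> <[a]>) <= type_weight G K)%N /\
  ((#[coset K a].-1 + type_weight G (K <*> <[a]>) = type_weight G K)%N ->
    #[coset K a] = exponent (G / K) \/
    exponent (G / (K <*> <[a]>)) = exponent (G / K)).
Proof.
move=> cGG; have [n] := ubnP (#|G| - #|K|); elim: n K => // n IHn K ltn sKG Ga.
have [eq_a|ne_a] := eqVneq #[coset K a] (exponent (G / K)).
  by rewrite (type_weight_max cGG sKG Ga eq_a); split=> // _; left.
have sKaG := joing_cycle_sub sKG Ga.
have [y Gy [oKy oKay]] := max_order2 cGG sKG sKaG.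
have sKyG := joing_cycle_sub sKG Gy.
have e0 : (0 < exponent (G / K))%N by apply: exponent_gt0.
have dvd_a : #[coset K a] %| exponent (G / K) by apply: dvdn_order_coset.
have lt_a : (#[coset K a] < exponent (G / K))%N by rewrite ltn_neqAle ne_a dvdn_leq.
(* The order of [y] modulo [K] exceeds that of [a], so it is at least 2 and [K] really grows. *)
have ltKKy : (#|K| < #|K <*> <[y]>|)%N.
  rewrite (card_joing_cycle cGG) // oKy -[X in (X < _)%N]muln1 ltn_pmul2l //.
  by apply: leq_trans lt_a; rewrite ltnS order_gt0.
have ltn' : (#|G| - #|K <*> <[y]>| < n)%N.
  have := subset_leq_card sKyG; move: ltKKy ltn; lia.
have [IH _] := IHn (K <*> <[y]>)%G ltn' sKyG Ga.
have eqJ : K <*> <[a]> <*> <[y]> = K <*> <[y]> <*> <[a]>.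
  by rewrite -!joingA [<[a]> <*> _]joingC.
rewrite (type_weight_max cGG sKG Gy oKy) (type_weight_max cGG sKaG Gy oKay) /=.
rewrite eqJ -oKay -oKy.
(* Counting K + <a> + <y> in both orders gives n e' = e n'. *)
have := card_joing_cycle (K := (K <*> <[y]>)%G) cGG sKyG Ga.
have := card_joing_cycle (K := (K <*> <[a]>)%G) cGG sKaG Gy.
rewrite /= eqJ => -> /eqP; rewrite !(card_joing_cycle cGG) // -!mulnA.
rewrite eqn_pmul2l // => /eqP eq_c.
have : (#[coset (K <*> <[a]>) y] <= #[coset K y])%N.
  by rewrite dvdn_leq ?order_gt0 // (@order_coset_subset G _ (K <*> <[a]>)%G) ?joing_subl.
rewrite -oKy in lt_a e0; move: IH eq_c lt_a e0 => /=.
have : (0 < #[coset (K <*> <[a]>) y])%N by apply: order_gt0.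
have : (0 < #[coset K a])%N by apply: order_gt0.
have : (0 < #[coset (K <*> <[y]>) a])%N by apply: order_gt0.
move: #[coset K a] #[coset K y] #[coset (K <*> <[a]>) y] #[coset (K <*> <[y]>) a]
  (type_weight _ _) (type_weight _ _) => n1 e e' n' w w'.
move=> n'0 n10 e'0 IH eq_c lt_n1 e0 le_e'.
have [le eq] := leq_cross_add eq_c lt_n1 le_e'.
clear -IH le eq n'0 n10 e'0 e0; split=> [|eq_w]; first lia.
by right; apply: eq; lia.
Qed.

End Quotients.

Local Open Scope ring_scope.

(** * Sumsets and the bound on the diameter *)

Section Additive.
Variable V : finZmodType.
Implicit Types (A : {set V}) (K : {group V}) (g h : V) (s : seq V).

Lemma sumset0E A g : (g \in sumset A 0) = (g == 0).
Proof.
rewrite inE; apply/existsP/eqP => [[f /andP[_ /eqP ->]]|->]; first by rewrite big_ord0.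
by exists [ffun=> 0]; rewrite big_ord0 eqxx andbT; apply/forallP => -[].
Qed.

Lemma sumsetSP A n g :
  reflect (exists2 b, b \in A0 A & g - b \in sumset A n) (g \in sumset A n.+1).
Proof.
apply: (iffP idP) => [|[b Ab]]; rewrite !inE.
  case/existsP=> f /andP[/forallP Af /eqP ->]; exists (f ord0) => //.
  rewrite inE; apply/existsP; exists [ffun i => f (lift ord0 i)].
  apply/andP; split; first by apply/forallP => i; rewrite ffunE.
  by rewrite big_ord_recl addrC addKr; apply/eqP/eq_bigr => i _; rewrite ffunE.
case/existsP=> f /andP[/forallP Af /eqP def_g]; apply/existsP.
exists [ffun i => if unlift ord0 i is Some j then f j else b].
apply/andP; split.
  by apply/forallP => i; rewrite ffunE; case: unliftP => // _; apply: Ab.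
rewrite big_ord_recl ffunE unlift_none -[g](subrK b) addrC def_g.
by apply/eqP; congr (_ + _); apply: eq_bigr => i _; rewrite ffunE liftK.
Qed.

Lemma sumsetD A m n g h :
  g \in sumset A m -> h \in sumset A n -> g + h \in sumset A (m + n).
Proof.
elim: m g => [|m IHm] g; first by rewrite sumset0E => /eqP ->; rewrite add0r.
case/sumsetSP=> b Ab gb hn; apply/sumsetSP; exists b => //.
by rewrite addrAC; apply: IHm.
Qed.

Lemma sumset_leq A m n g : (m <= n)%N -> g \in sumset A m -> g \in sumset A n.
Proof.
move/subnK <-; rewrite addnC => gm; rewrite -[g]addr0; apply: sumsetD => //.
elim: (n - m)%N => [|k IHk]; first by rewrite sumset0E.
by apply/sumsetSP; exists 0; rewrite ?subr0 // !inE eqxx orbT.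
Qed.

Lemma sumset1 A b : b \in A0 A -> b \in sumset A 1.
Proof. by move=> Ab; apply/sumsetSP; exists b; rewrite ?subrr ?sumset0E. Qed.

Lemma sumset_mulrn A b n : b \in A0 A -> b *+ n \in sumset A n.
Proof.
move=> Ab; elim: n => [|n IHn]; first by rewrite mulr0n sumset0E.
by rewrite mulrS -add1n; apply: sumsetD => //; apply: sumset1.
Qed.

Lemma sumset_gen A n g : g \in sumset A n -> g \in <<A>>%g.
Proof.
elim: n g => [|n IHn] g; first by rewrite sumset0E => /eqP ->; apply: (group1 <<A>>).
case/sumsetSP=> b Ab /IHn gA; rewrite -[g](subrK b).
by apply: (groupM gA); case/setUP: Ab => [/mem_gen //|/set1P ->]; apply: (group1 <<A>>).
Qed.

(** Saying inside [V] that the d-fold sums of A_0 meet every coset of [K] avoids images of [A] in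
    varying quotients. *)
Definition covers A (K : {set V}) d :=
  forall g, exists2 s, s \in sumset A d & g - s \in K.

Lemma covers_leq A K m n : (m <= n)%N -> covers A K m -> covers A K n.
Proof. by move=> le cov g; have [s /(sumset_leq le)] := cov g; exists s. Qed.

Lemma order_coset_mulrn K x n : (#[coset K x]%g %| n)%N = (x *+ n \in K).
Proof.
by rewrite (order_coset_dvdn _ (zmod_abelian [set: V]%G)) ?inE ?subsetT ?zmodXgE.
Qed.

Lemma joing_cycleP K a g :
  reflect (exists l, g - a *+ l \in K) (g \in K <*> <[a]>)%g.
Proof.
have cVV := zmod_abelian [set: V]%G.
rewrite norm_joinEr; last first.
  exact: (subset_trans (subsetT _) (sub_abelian_norm cVV (subsetT K))).
apply: (iffP mulsgP) => [[k x Kk /cycleP[l ->] ->]|[l Kl]].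
  by exists l; rewrite zmodXgE zmodMgE addrK.
exists (g - a *+ l) (a *+ l) => //; last by rewrite zmodMgE subrK.
by rewrite -zmodXgE mem_cycle.
Qed.

(** Modulo [K] the coefficient of [a] can be reduced below the order of [a], so fewer further
    summands than that order suffice. *)
Lemma covers_cycle A K a d :
    a \in A -> covers A (K <*> <[a]>)%g d ->
  covers A K (#[coset K a]%g.-1 + d).
Proof.
move=> Aa cov g; have [s sd /joing_cycleP[l Kl]] := cov g.
set n := #[_]%g; have n0 : (0 < n)%N by apply: order_gt0.
exists (a *+ (l %% n) + s).
  apply: sumsetD sd; apply: (@sumset_leq _ (l %% n)%N).
    by rewrite -ltnS prednK ?ltn_mod.
  by apply: sumset_mulrn; rewrite inE Aa.
have : a *+ (l %/ n * n) \in K by rewrite -order_coset_mulrn dvdn_mull.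
move/(groupM Kl); rewrite zmodMgE.
by rewrite {1}(divn_eq l n) mulrnDr !opprD !addrA addrAC subrK addrAC.
Qed.

(** The second claim propagates: if adjoining [a] loses nothing and [a] is not of maximal order,
    then the exponent is unchanged, so no element of [A] has maximal order modulo K + <a> either. *)
Lemma type_weight_bound A K :
    <<A>>%g = [set: V] ->
  covers A K (type_weight [set: V] K) /\
  (K != [set: V] :> {set V} ->
   (forall a, a \in A -> #[coset K a]%g != exponent ([set: V] / K)%g) ->
   exists2 d, (d < type_weight [set: V] K)%N & covers A K d).
Proof.
move=> genA; have cVV := zmod_abelian [set: V]%G.
have [n] := ubnP (#|V| - #|K|)%N; elim: n K => // n IHn K ltn.
have [eqK|neK] := eqVneq (K : {set V}) [set: V].
  split=> // g; exists 0; last by rewrite eqK inE.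
  by apply: (@sumset_leq _ 0); rewrite ?sumset0E.
have [a Aa Ka] : exists2 a, a \in A & a \notin K.
  apply/subsetPn; apply: contra neK => sAK.
  by rewrite eqEsubset subsetT -genA gen_subG.
have ltKa : (#|K| < #|(K <*> <[a]>)%g|)%N.
  apply: proper_card; rewrite properE joing_subl /=; apply/subsetPn; exists a => //.
  by apply/joing_cycleP; exists 1%N; rewrite subrr; apply: (group1 K).
have ltn' : (#|V| - #|(K <*> <[a]>)%g| < n)%N.
  have : (#|(K <*> <[a]>)%g| <= #|V|)%N by apply: max_card.
  by move: ltKa ltn; rewrite /=; lia.
have [IH1 IH2] := IHn (K <*> <[a]>)%G ltn'.
have [le_w eq_w] := @type_weight_cycle V [set: V]%G K a cVV (subsetT _) (in_setT _).
have covK := covers_cycle Aa IH1.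
split=> [|_ noA]; first exact: covers_leq covK.
move: le_w; rewrite leq_eqVlt => /orP[/eqP/eq_w|lt_w]; last first.
  by exists (#[coset K a]%g.-1 + type_weight [set: V] (K <*> <[a]>)%g)%N.
case=> [/eqP|eq_e]; first by rewrite (negPf (noA a Aa)).
have [||d lt_d covd] := IH2.
(* If K + <a> were everything, the unchanged exponent would be 1 and [K] would be everything too. *)
- apply: contraNneq neK => /= eqKa; move: eq_e; rewrite eqKa trivg_quotient exponent1.
  move/esym/eqP; rewrite -dvdn1 -trivg_exponent.
  by rewrite -subG1 quotient_sub1 ?sub_abelian_norm ?subsetT // eqEsubset subsetT.
- move=> b Ab; apply: contra (noA b Ab) => /eqP eq_b.
  rewrite eqn_dvd dvdn_order_coset ?inE //= -eq_e -eq_b.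
  by apply: (order_coset_subset cVV); rewrite ?joing_subl ?subsetT ?inE.
exists (#[coset K a]%g.-1 + d)%N; last exact: covers_cycle covd.
have [le _] := @type_weight_cycle V [set: V]%G K a cVV (subsetT _) (in_setT _).
by apply: leq_trans le; rewrite ltn_add2l.
Qed.

(** * Towers of elements of maximal order *)

Definition seq_span s : {set V} := <<[set x in s]>>%g.
Canonical seq_span_group s := [group of seq_span s].

Lemma seq_span_nil : seq_span [::] = 1%g.
Proof. by rewrite /seq_span set_nil gen0. Qed.

Lemma seq_span_cons a s : seq_span (a :: s) = (seq_span s <*> <[a]>)%g.
Proof. by rewrite /seq_span set_cons joing_idl joing_idr setUC. Qed.

(** The newest element is the head of [s], and [T] lists the largest invariant first, so index [i]
    of [s] pairs with index n - i - 1 of [T]. The failure of small coverings is carried along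
    because it produces the next element. *)
Lemma max_order_tower A n :
    let T := abelian_type [set: V] in
    <<A>>%g = [set: V] ->
    (forall d, (d < type_weight [set: V] 1%g)%N -> ~ covers A 1%g d) ->
    (n <= size T)%N ->
  exists s, [/\ size s = n, {subset s <= A},
    abelian_type ([set: V] / seq_span s)%g = drop n T,
    (forall d, (d < type_weight [set: V] (seq_span s))%N -> ~ covers A (seq_span s) d)
    & forall i, (i < n)%N ->
        (forall k, (nth 0 s i *+ k \in seq_span (drop i.+1 s)) = (nth 0 T (n - i.+1) %| k)%N) /\
        (forall g, g *+ nth 0 T (n - i.+1) \in seq_span (drop i.+1 s))].
Proof.
move=> T genA no_cov; have cVV := zmod_abelian [set: V].
elim: n => [|n IHn] le_n.
  exists [::]; rewrite seq_span_nil drop0; split=> //.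
  by apply/esym/isog_abelian_type/quotient1_isog.
have [s [ss sA Ts no_s nth_s]] := IHn (ltnW le_n).
have ltT : seq_span s \proper [set: V].
  rewrite properEneq subsetT andbT; apply/eqP => eqH.
  move: Ts; rewrite eqH trivg_quotient (drop_nth 0%N le_n).
  by rewrite /abelian_type cards1 /= genGid eqxx andbF.
have [/existsP[a /andP[Aa /eqP oa]]|/existsPn no_a] :=
  boolP [exists a, (a \in A) && (#[coset (seq_span s) a]%g == exponent ([set: V] / seq_span s)%g)];
  last first.
  (* Without an element of maximal order the strict bound would contradict [no_s]. *)
  have [] := type_weight_bound (seq_span_group s) genA.
  move=> _ [||d lt_d cov_d].
  - by move: ltT; rewrite properEneq => /andP[].
  - by move=> a Aa; have := no_a a; rewrite Aa.
  by case: (no_s d lt_d).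
have Ts' := abelian_type_quotient_max cVV ltT (in_setT a) oa.
have Tn : #[coset (seq_span s) a]%g = nth 0 T n.
  by move: Ts; rewrite Ts' (drop_nth 0%N le_n) => -[].
exists (a :: s); split.
- by rewrite /= ss.
- by move=> x; rewrite inE => /predU1P[->|/sA].
- by move: Ts; rewrite seq_span_cons Ts' (drop_nth 0%N le_n) => -[].
- move=> d lt_d cov_d.
  apply: (no_s (#[coset (seq_span s) a]%g.-1 + d)%N); last first.
    by apply: covers_cycle => //; rewrite -seq_span_cons.
  rewrite (type_weight_max cVV (subsetT _) (in_setT a) oa) ltn_add2l.
  by rewrite -seq_span_cons.
case=> [_|i lt_i]; last by have := nth_s i lt_i; rewrite /= subSS.
rewrite /= drop0 subn1 /= -Tn; split=> [k|g]; first by rewrite order_coset_mulrn.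
by rewrite -order_coset_mulrn oa dvdn_order_coset ?in_setT.
Qed.

(** The list [abelian_type] starts with the largest invariant, opposite to [m]; hence [rev]. *)
Lemma abelian_type_std_gen r (m : 'I_r -> nat) (e : 'I_r -> V) :
    (forall i, (1 < m i)%N) -> (forall i j : 'I_r, (i <= j)%N -> (m i %| m j)%N) ->
    std_gen m e ->
  abelian_type [set: V] = rev (map m (enum 'I_r)).
Proof.
move=> m1 mdiv [defV oe].
have eq_o : map (@order V) (rev (map e (enum 'I_r))) = rev (map m (enum 'I_r)).
  by rewrite map_rev -map_comp; congr rev; apply: eq_map => i /=; rewrite oe.
rewrite -eq_o; apply/esym/abelian_type_unique.
- by rewrite big_rev big_map big_enum.
- rewrite eq_o rev_sorted sorted_map.
  have : sorted ltn (map val (enum 'I_r)) by rewrite val_enum_ord iota_ltn_sorted.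
  by rewrite sorted_map; apply: sub_sorted => i j /= /ltnW; apply: mdiv.
by rewrite eq_o all_rev; apply/allP => _ /mapP[i _ ->] /=.
Qed.

End Additive.

(** * Coordinates *)

Lemma sum_delta_nat (I : finType) (i : I) (c : nat) : (\sum_k (k == i) * c = c)%N.
Proof.
by rewrite (bigD1 i) //= eqxx mul1n big1 ?addn0 // => k /negPf ->; rewrite mul0n.
Qed.

(** One nonzero multiple of [d] already exhausts the sum. The case d = 1 serves for the elements of
    A, the case d = m_i for the relations. *)
Lemma dvdn_sum_single (I : finType) (d : nat) (lam : I -> nat) :
    (0 < d)%N -> (forall k, d %| lam k)%N -> (\sum_k lam k <= d)%N ->
  (forall k, lam k = 0%N) \/ exists j, forall k, lam k = ((k == j) * d)%N.
Proof.
move=> d0 dvd le_d.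
have [/forallP all0|/forallPn[j nz]] := boolP [forall k, lam k == 0%N].
  by left=> k; apply/eqP.
have le_dj : (d <= lam j)%N by rewrite dvdn_leq // lt0n.
have le_j : (lam j + \sum_(k | k != j) lam k <= d)%N by move: le_d; rewrite (bigD1 j).
right; exists j => k; have [->|nk] := eqVneq k j; first by lia.
have : (\sum_(k | k != j) lam k == 0)%N by lia.
by rewrite sum_nat_eq0 => /forallP/(_ k); rewrite nk => /eqP.
Qed.

Section Coordinates.
Variables (V : finZmodType) (r : nat).
Implicit Types (A : {set V}) (g h : V) (a e : 'I_r -> V) (m lam mu : 'I_r -> nat).

Lemma sum_delta a i c : \sum_k a k *+ ((k == i) * c) = a i *+ c.
Proof.
by rewrite (bigD1 i) //= eqxx mul1n big1 ?addr0 // => k /negPf ->; rewrite mul0n.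
Qed.

Lemma sum_mulrnD a lam mu :
  \sum_k a k *+ (lam k + mu k) = \sum_k a k *+ lam k + \sum_k a k *+ mu k.
Proof. by rewrite -big_split; apply: eq_bigr => k _; rewrite mulrnDr. Qed.

Lemma sum_mulrnM a lam c : \sum_k a k *+ (lam k * c) = (\sum_k a k *+ lam k) *+ c.
Proof. by rewrite -sumrMnl; apply: eq_bigr => k _; rewrite mulrnA. Qed.

Lemma gen_mulrn_sum a (P : pred 'I_r) g :
    g \in <<[set a i | i in P]>>%g ->
  exists2 x : 'I_r -> nat, forall i, ~~ P i -> x i = 0%N & g = \sum_i a i *+ x i.
Proof.
case/gen_prodgP=> n [c Ac ->]; elim: n c Ac => [|n IHn] c Ac.
  exists (fun=> 0%N) => //; rewrite big_ord0 big1 // => i _.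
have [i|x x0 def_x] := IHn (fun i => c (lift ord0 i)); first exact: Ac.
have /imsetP[j Pj def_c] := Ac ord0.
exists (fun k => (k == j) * 1 + x k)%N => [k nPk|].
  by rewrite x0 // addn0; case: eqP nPk => // ->; rewrite [~~ _](negPf _) //= negbK.
by rewrite big_ord_recl def_x def_c zmodMgE sum_mulrnD sum_delta.
Qed.

Lemma comb_sumset A a lam :
  (forall i, a i \in A0 A) -> \sum_i a i *+ lam i \in sumset A (\sum_i lam i).
Proof.
move=> Aa; apply: (big_rec2 (fun n g => g \in sumset A n)) => [|i n g _ gn].
  by rewrite sumset0E.
by apply: sumsetD gn; apply: sumset_mulrn.
Qed.

Lemma sumset_comb A a d g :
    A0 A = 0 |: [set a i | i : 'I_r] -> g \in sumset A d ->
  exists2 lam : 'I_r -> nat, g = \sum_i a i *+ lam i & (\sum_i lam i <= d)%N.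
Proof.
move=> defA; elim: d g => [|d IHd] g.
  rewrite sumset0E => /eqP ->; exists (fun=> 0%N); last by rewrite big1.
  by rewrite big1.
case/sumsetSP=> b; rewrite defA => /setU1P[->|/imsetP[i _ ->]] /IHd[lam def_g le_d].
  by exists lam; rewrite ?(leqW le_d) // -def_g subr0.
exists (fun k => (k == i) * 1 + lam k)%N.
  by rewrite sum_mulrnD sum_delta -def_g mulr1n addrC subrK.
by rewrite big_split /= sum_delta_nat.
Qed.

(* [b] switches on the control of the length. *)
Definition triangular (b : bool) m a (j : 'I_r) :=
  exists x : 'I_r -> nat,
    [/\ forall k : 'I_r, (k <= j)%N -> x k = 0%N,
        a j *+ m j = \sum_k a k *+ x k,
        forall k, (m j %| x k)%N
      & b -> (\sum_k x k <= m j)%N].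

(** Carrying: from position [t] upwards, each digit is reduced modulo m_j and its quotient is passed
    to later positions by the relation. Common divisors of the m_j and the digits survive, and the
    digit sum does not grow when [b] holds. *)
Lemma triangular_reduce b m a (t : nat) mu :
    (forall i, 0 < m i)%N ->
    (forall j : 'I_r, (t <= j)%N -> triangular b m a j) ->
    (forall k : 'I_r, (k < t)%N -> mu k = 0%N) ->
  exists lam,
    [/\ forall k : 'I_r, (k < t)%N -> lam k = 0%N,
        forall k, (lam k < m k)%N,
        \sum_k a k *+ lam k = \sum_k a k *+ mu k,
        forall d, (forall j : 'I_r, (t <= j)%N -> d %| m j)%N ->
          (forall k, d %| mu k)%N -> forall k, (d %| lam k)%N
      & b -> (\sum_k lam k <= \sum_k mu k)%N].
Proof.
move=> m0; have [n] := ubnP (r - t)%N; elim: n t mu => // n IHn t mu lt_n rel mu0.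
have [le_rt|lt_tr] := leqP r t.
  exists mu; split=> // k; rewrite mu0 //; exact: leq_trans (ltn_ord k) le_rt.
pose j := Ordinal lt_tr; have [x [x0 def_x dvd_x le_x]] := rel j (leqnn t).
(* Here [q] is the carry, [rho] the digit that stays, and [mu0'] collects the other digits. *)
pose q := (mu j %/ m j)%N; pose rho := (mu j %% m j)%N.
pose mu0' k := if k == j then 0%N else mu k.
have mu_eq k : mu k = ((k == j) * mu j + mu0' k)%N.
  by rewrite /mu0'; case: eqP => [->|]; lia.
have [||k ltk|lam [lam0 lt_lam def_lam dvd_lam le_lam]] := IHn t.+1 (fun k => x k * q + mu0' k)%N.
- by lia.
- by move=> k /ltnW; apply: rel.
- rewrite x0 //= /mu0'; case: eqP => // /eqP ne; rewrite mu0 //.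
  by rewrite ltn_neqAle -ltnS ltk andbT.
exists (fun k => (k == j) * rho + lam k)%N; split.
- move=> k ltk; rewrite lam0 ?(leqW ltk) //.
  by rewrite -val_eqE /= (ltn_eqF ltk).
- move=> k; case: eqP => [->|_]; last by rewrite mul0n add0n.
  by rewrite lam0 //= addn0 mul1n ltn_mod m0.
- rewrite sum_mulrnD sum_delta def_lam sum_mulrnD sum_mulrnM -def_x.
  under [RHS]eq_bigr do rewrite mu_eq.
  by rewrite sum_mulrnD sum_delta addrA -mulrnA -mulrnDr addnC mulnC -divn_eq.
- move=> d dm dmu k; apply: dvdn_add.
    apply: dvdn_mull; have := dmu j.
    by rewrite {1}(divn_eq (mu j) (m j)) dvdn_addr // dvdn_mull // dm.
  apply: dvd_lam => [i /ltnW|i]; first exact: dm.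
  apply: dvdn_add; first by apply: dvdn_mulr; apply: dvdn_trans (dvd_x i); apply: dm.
  by rewrite /mu0'; case: eqP.
move=> bT; rewrite big_split /= sum_delta_nat.
under [X in (_ <= X)%N]eq_bigr do rewrite mu_eq.
rewrite big_split /= sum_delta_nat.
have := le_lam bT; rewrite big_split /= -big_distrl /=.
move=> le_lam'; rewrite {1}(divn_eq (mu j) (m j)) -/q -/rho.
apply: leq_trans (leq_add (leqnn rho) le_lam') _.
by rewrite addnA leq_add2r addnC leq_add2r [(q * _)%N]mulnC leq_mul ?le_x.
Qed.

Lemma seq_span_drop_sum (s : seq V) i g :
    size s = r -> g \in seq_span (drop i s) ->
  exists2 x : 'I_r -> nat, forall k : 'I_r, (k < i)%N -> x k = 0%N &
    g = \sum_(k < r) nth 0 s k *+ x k.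
Proof.
move=> ss gs; pose a (k : 'I_r) := nth 0 s k; pose P (k : 'I_r) := (i <= k)%N.
have [|x x0 ->] := @gen_mulrn_sum a P g.
  apply: subsetP gs; apply: genS; apply/subsetP => y; rewrite inE => /(nthP 0)[k].
  rewrite size_drop ss nth_drop => lt_k <-.
  have lt_ik : (i + k < r)%N by lia.
  by apply/imsetP; exists (Ordinal lt_ik) => //; rewrite unfold_in /P /= leq_addr.
by exists x => // k lt_k; rewrite x0 // /P -ltnNge.
Qed.

(* Lifting the relation [m i * a_i = 0] from the quotient by the span of the later terms,
   one cyclic factor at a time. *)
Lemma tower_triangular (s : seq V) m :
    size s = r -> (forall i, 0 < m i)%N ->
    (forall i j : 'I_r, (i <= j)%N -> (m i %| m j)%N) ->
    (forall i : 'I_r,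
      (forall k, (nth 0 s i *+ k \in seq_span (drop i.+1 s)) = (m i %| k)%N) /\
      (forall g, g *+ m i \in seq_span (drop i.+1 s))) ->
  forall i, triangular false m (fun k : 'I_r => nth 0 s k) i.
Proof.
move=> ss m0 mdiv tow i.
(* The correction [h] grows so as to push m_i (a_i - h) into the span of ever later terms. *)
have lift n : (i.+1 + n <= r)%N -> exists2 h, h \in seq_span (drop i.+1 s) &
    (nth 0 s i - h) *+ m i \in seq_span (drop (i.+1 + n) s).
  elim: n => [|n IHn] le_n.
    by exists 0; [apply: (group1 (seq_span_group _)) | rewrite subr0 addn0; case: (tow i)].
  rewrite addnS in le_n; have [h Hh] := IHn (ltnW le_n).
  pose k := Ordinal le_n; have [tow1 tow2] := tow k.
  rewrite (drop_nth 0) ?ss // seq_span_cons => /joing_cycleP[c].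
  rewrite -[(i.+1 + n)%N]/(val k) => Hc.
  have /dvdnP[q def_q] : (m i %| m k)%N by apply: mdiv; rewrite /k /=; lia.
  have q0 : (0 < q)%N by move: (m0 k); rewrite def_q muln_gt0 => /andP[].
  (* Multiplied by q = m_k / m_i, the element becomes m_k (a_i - h) - q c a_k, whose first term lies
     in the span after [k]; so m_k divides q c, and m_i divides [c]. *)
  have /dvdnP[c' def_c] : (m i %| c)%N.
    rewrite -(dvdn_pmul2l q0) -def_q [(q * c)%N]mulnC -tow1.
    have := groupX q Hc; rewrite zmodXgE mulrnBl -!mulrnA [(m i * q)%N]mulnC -def_q => Hq.
    have := groupM (groupVr Hq) (tow2 (nth 0 s i - h)).
    by rewrite zmodMgE zmodVgE opprB subrK.
  exists (h + nth 0 s k *+ c').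
    apply: (groupM Hh); rewrite -zmodXgE; apply: groupX; apply: mem_gen.
    rewrite inE; apply/(nthP 0); exists n; rewrite ?nth_drop // size_drop ss.
    by move: (le_n); lia.
  by rewrite addnS opprD addrA mulrnBl -mulrnA -def_c.
have [|h Hh] := lift (r - i.+1)%N; first by have := ltn_ord i; lia.
rewrite subnKC ?ltn_ord // drop_oversize ?ss // seq_span_nil.
move/set1gP; rewrite zmod1gE mulrnBl => /eqP; rewrite subr_eq0 => /eqP def_a.
have [x x0 def_h] := seq_span_drop_sum ss Hh.
exists (fun k => x k * m i)%N; split=> //.
- by move=> k le_k; rewrite x0.
- by rewrite sum_mulrnM -def_h.
by move=> k; apply: dvdn_mull.
Qed.

(** * Consequences of maximal length *)

(** Among the reduced combinations only [top] has digit sum [phi]. As fewer than [phi] summands do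
    not reach all of [V], it is [top] that needs [phi] of them. *)
Lemma max_length_form A a m :
    (forall i, 1 < m i)%N -> (forall i j : 'I_r, (i <= j)%N -> (m i %| m j)%N) ->
    (forall i, a i \in A) ->
    (forall g, exists mu, g = \sum_i a i *+ mu i) ->
    (forall i, triangular false m a i) ->
    (forall d, (d < \sum_i (m i).-1)%N -> sumset A d <> [set: V]) ->
  A0 A = 0 |: [set a i | i : 'I_r] /\
  (forall i, a i *+ m i = 0 \/ exists2 j : 'I_r, (i < j)%N & a i *+ m i = a j *+ m i).
Proof.
move=> m1 mdiv Aa gen rel no_d; have m0 i : (0 < m i)%N by apply: ltnW.
have A0a i : a i \in A0 A by rewrite inE Aa.
have reps g : exists2 lam : 'I_r -> nat, forall i, (lam i < m i)%N & g = \sum_i a i *+ lam i.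
  have [mu ->] := gen g.
  have [//|lam [_ lt_lam def_lam _ _]] :=
    triangular_reduce (t := 0%N) (mu := mu) m0 (fun j _ => rel j).
  by exists lam.
set phi := (\sum_i _)%N in no_d.
set top := \sum_i a i *+ (m i).-1.
have top_far d : top \in sumset A d -> (phi <= d)%N.
  move=> top_d; rewrite leqNgt; apply/negP => lt_d.
  have phi0 : (0 < phi)%N by apply: leq_ltn_trans lt_d.
  apply: (no_d phi.-1); first by rewrite prednK.
  apply/eqP; rewrite eqEsubset subsetT; apply/subsetP => g _.
  have [lam lt_lam ->] := reps g.
  have le_lam i : (lam i <= (m i).-1 ?= iff (lam i == (m i).-1))%N.
    by split=> //; rewrite -ltnS prednK.
  have [le_sum] := leqif_sum (fun i (_ : true) => le_lam i).
  case: eqP => [_ /esym/forallP all_eq|/eqP ne _].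
    rewrite (eq_bigr (fun i => a i *+ (m i).-1)); last by move=> i _; rewrite (eqP (all_eq i)).
    by apply: sumset_leq top_d; move: lt_d; case: (phi).
  apply: sumset_leq (comb_sumset lam A0a).
  by rewrite -ltnS prednK // ltn_neqAle ne.
(* Completing the digits to m_i - 1 would turn a shorter expression of this combination into a
   shorter one of [top]. *)
have far lam d : (forall i, lam i < m i)%N -> \sum_i a i *+ lam i \in sumset A d ->
    (\sum_i lam i <= d)%N.
  move=> lt_lam lam_d.
  have split_m i : (m i).-1 = (lam i + ((m i).-1 - lam i))%N.
    by rewrite subnKC // -ltnS prednK.
  have : top \in sumset A (d + \sum_i ((m i).-1 - lam i)).
    rewrite /top (eq_bigr _ (fun i _ => congr1 (fun n => a i *+ n) (split_m i))).
    by rewrite sum_mulrnD; apply: sumsetD => //; apply: comb_sumset.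
  move/top_far; rewrite /phi (eq_bigr _ (fun i _ => split_m i)) big_split /=.
  by rewrite leq_add2r.
split.
  apply/eqP; rewrite eqEsubset; apply/andP; split; apply/subsetP => b.
    (* An element of A_0 has length at most 1, so its reduced digits sum to at most 1. *)
    have [lam lt_lam def_b] := reps b; move/sumset1; rewrite def_b => /(far _ _ lt_lam).
    case/(dvdn_sum_single (d := 1%N)) => // [lam0|[j lam1]].
      by rewrite big1 ?setU11 // => k _; rewrite lam0.
    apply/setU1P; right; apply/imsetP; exists j => //.
    by rewrite (eq_bigr _ (fun k _ => congr1 (fun n => a k *+ n) (lam1 k))) sum_delta.
  by case/setU1P=> [->|/imsetP[i _ ->]] //; rewrite !inE eqxx orbT.
move=> i; have [x [x0 def_x dvd_x _]] := rel i.
(* Starting at [i.+1] keeps the support after [i], where every m_j is a multiple of m_i. *)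
have [|lam [lam0 lt_lam def_lam dvd_lam _]] := triangular_reduce (t := i.+1) m0
   (fun j _ => rel j) (mu := x); first by move=> k /ltnSE; apply: x0.
have dvd_i : forall k, (m i %| lam k)%N.
  by apply: dvd_lam => // j /ltnW; apply: mdiv.
have : (\sum_k lam k <= m i)%N.
  by apply: far => //; rewrite def_lam -def_x; apply: sumset_mulrn.
case/(dvdn_sum_single (m0 i) dvd_i) => [lam_0|[j lam_j]].
  by left; rewrite def_x -def_lam big1 // => k _; rewrite lam_0.
right; exists j.
  rewrite ltnNge; apply/negP => le_ji; have := lam0 j; rewrite ltnS lam_j eqxx => /(_ le_ji).
  by move: (m0 i); case: (m i).
by rewrite def_x -def_lam (eq_bigr _ (fun k _ => congr1 (fun n => a k *+ n) (lam_j k))) sum_delta.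
Qed.

Lemma std_gen_card m e : std_gen m e -> (\prod_i m i)%N = #|V|.
Proof.
case=> defV oe; rewrite -cardsT -(bigdprod_card (G := [set: V]%G) defV).
by apply: eq_bigr => i _; rewrite -oe.
Qed.

(** The e_i generate, and their orders divide the m_i, whose product is |V|; so the sum is direct
    and every order is exact. *)
Lemma std_gen_intro m e a :
    (forall i, 0 < m i)%N -> (\prod_i m i)%N = #|V| ->
    (forall g, exists mu, g = \sum_i a i *+ mu i) ->
    (forall i, e i *+ m i = 0) ->
    (forall i : 'I_r, a i = e i \/ exists j : 'I_r, (i < j)%N /\ a i = e i + a j) ->
  std_gen m e.
Proof.
move=> m0 cardV gen e0 rel.
have dvd_e i : (#[e i]%g %| m i)%N by rewrite order_dvdn zmodXgE e0 zmod1gE.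
have defV : \big[cprod/1%g]_(i < r) <[e i]>%g = [set: V].
  have defL := @bigcprodEY V 'I_r (index_enum _) xpredT (fun i => <[e i]>%G) [set: V]%G
    (zmod_abelian _) (fun i _ => subsetT _).
  set L := (\prod_(i < r) _)%G in defL.
  have Le i : e i \in L.
    rewrite -(bigcprodWY defL) mem_gen //; apply/bigcupP; exists i => //.
    exact: cycle_id.
  have La i : a i \in L.
    (* Downward induction on [i], since a_i involves only e_i and a later a_j. *)
    have [n] := ubnP (r - i)%N; elim: n i => // n IHn i lt_n.
    case: (rel i) => [->|[j [lt_ij ->]]]; first exact: Le.
    by apply: groupM; [apply: Le | apply: IHn; have := ltn_ord j; lia].
  apply: etrans defL _; apply/eqP; rewrite eqEsubset subsetT; apply/subsetP => g _.
  have [mu ->] := gen g; apply: (big_ind (fun h => h \in L)) => [|x y|i _].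
  - exact: group1.
  - exact: groupM.
  - by rewrite -zmodXgE groupX.
have le_e i : (#[e i]%g <= m i)%N by apply: dvdn_leq.
have dprodV : \big[dprod/1%g]_(i < r) <[e i]>%g = [set: V].
  apply: (bigcprod_card_dprod (G := [set: V]%G)) => //.
  by rewrite cardsT -cardV; apply: leq_prod => i _; apply: le_e.
split=> // i; apply/eqP; rewrite eqn_leq le_e leqNgt; apply/negP => lt_i.
have := bigdprod_card (G := [set: V]%G) dprodV; rewrite cardsT -cardV => /eqP.
rewrite (bigD1 i) //= [X in _ == X](bigD1 i) //= eqn_leq => /andP[_].
rewrite leqNgt => /negP[].
apply: leq_ltn_trans (_ : #[e i]%g * \prod_(j | j != i) m j < _)%N.
  by rewrite leq_mul //; apply: leq_prod => j _; apply: le_e.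
by rewrite ltn_pmul2r // prodn_cond_gt0 // => j _.
Qed.

(** * Sets of the special form *)

Section Special.
Variables (m : 'I_r -> nat) (A : {set V}) (e a : 'I_r -> V).
Hypotheses (m1 : forall i, (1 < m i)%N) (std : std_gen m e) (form : special_form A e a).

Lemma special_form_mem i : a i \in A0 A.
Proof. by case: form => -> _; rewrite inE; apply/orP; right; apply: imset_f. Qed.

(** Since m_j e_j = 0, the relation reads m_j a_j = 0 or m_j a_j = m_j a_k, so a carry never
    lengthens a combination. *)
Lemma special_form_triangular j : triangular true m a j.
Proof.
have e0 : e j *+ m j = 0 by case: std => _ <-; rewrite -zmodXgE expg_order.
case: form => _ /(_ j)[def_a|[k [lt_jk def_a]]].
  exists (fun=> 0%N); split=> [//||//|_]; last by rewrite big1.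
  by rewrite def_a e0 big1.
exists (fun i => (i == k) * m j)%N; split.
- by move=> i le_ij; case: eqP le_ij => // ->; rewrite leqNgt lt_jk.
- by rewrite sum_delta def_a mulrnDl e0 add0r.
- by move=> i; apply: dvdn_mull.
by rewrite sum_delta_nat.
Qed.

Lemma special_form_gen g : exists mu, g = \sum_i a i *+ mu i.
Proof.
have [defV _] := std.
suff: g \in <<[set a i | i in 'I_r]>>%g by case/gen_mulrn_sum=> mu _ ->; exists mu.
suff: [set: V] \subset <<[set a i | i in 'I_r]>>%g by move/subsetP; apply; rewrite inE.
rewrite -(bigdprodWY (G := [set: V]%G) defV) gen_subG; apply/bigcupsP => i _.
rewrite cycle_subG; have La k : a k \in <<[set a i | i in 'I_r]>>%g.
  by rewrite mem_gen ?imset_f.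
case: form => _ /(_ i)[<- //|[k [_ def_a]]].
have -> : e i = a i - a k by rewrite def_a addrK.
exact: groupM (La i) (groupVr (La k)).
Qed.

Lemma special_form_reduce mu :
  exists lam, [/\ forall i, (lam i < m i)%N, \sum_i a i *+ lam i = \sum_i a i *+ mu i
                & (\sum_i lam i <= \sum_i mu i)%N].
Proof.
have [//|lam [_ lt_lam def_lam _ le_lam]] := triangular_reduce (t := 0%N) (mu := mu)
  (fun i => ltnW (m1 i)) (fun j _ => special_form_triangular j).
by exists lam; split=> //; apply: le_lam.
Qed.

(* The combinations with digits below [m i] are as many as the elements of the group. *)
Lemma special_form_unique lam mu :
    (forall i, (lam i < m i)%N) -> (forall i, (mu i < m i)%N) ->
    \sum_i a i *+ lam i = \sum_i a i *+ mu i ->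
  forall i, lam i = mu i.
Proof.
move=> lt_lam lt_mu eq_lm.
pose f (d : {dffun forall i, 'I_(m i)}) := \sum_i a i *+ d i.
have f_inj : {in predT &, injective f}.
  apply/image_injP/eqP; transitivity #|V|.
    apply: eq_card => g; rewrite [RHS]inE; apply/imageP.
    have [nu ->] := special_form_gen g; have [kap [lt_kap <- _]] := special_form_reduce nu.
    by exists [ffun i => Ordinal (lt_kap i)] => //; apply: eq_bigr => i _; rewrite ffunE.
  rewrite [RHS]card_dep_ffun -(std_gen_card std) foldrE big_map -big_enum /=.
  by rewrite enumT; apply: eq_bigr => i _; rewrite card_ord.
have := f_inj [ffun i => Ordinal (lt_lam i)] [ffun i => Ordinal (lt_mu i)] isT isT.
move=> eq_f i; have /ffunP/(_ i) : [ffun i => Ordinal (lt_lam i)] = [ffun i => Ordinal (lt_mu i)]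
   :> {dffun forall i, 'I_(m i)}.
  apply: eq_f; rewrite /f; under eq_bigr do rewrite ffunE.
  by under [RHS]eq_bigr do rewrite ffunE.
by rewrite !ffunE => /(congr1 val).
Qed.

(** Any expression over A_0 reduces to digits below m_i without growing, and by uniqueness these
    digits are [lam]. *)
Lemma special_form_length lam :
    (forall i, (lam i < m i)%N) ->
  length_is A (\sum_i a i *+ lam i) (\sum_i lam i)%N.
Proof.
move=> lt_lam; split; first exact: comb_sumset special_form_mem.
move=> k; case: form => defA _ /(sumset_comb defA)[mu def_mu le_mu].
have [nu [lt_nu def_nu le_nu]] := special_form_reduce mu.
rewrite (eq_bigr nu) ?(leq_trans le_nu) // => i _.
by apply: special_form_unique => //; rewrite def_nu.
Qed.

Lemma special_form_diam : diamA_is A (\sum_i (m i).-1)%N.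
Proof.
split.
  apply/eqP; rewrite eqEsubset subsetT; apply/subsetP => g _.
  have [mu ->] := special_form_gen g; have [lam [lt_lam <- _]] := special_form_reduce mu.
  have [] := special_form_length lt_lam; move=> + _; apply: sumset_leq.
  by apply: leq_sum => i _; rewrite -ltnS prednK // ltnW.
move=> k covk; have [|_] := @special_form_length (fun i => (m i).-1).
  by move=> i; rewrite prednK // ltnW.
by apply; rewrite covk inE.
Qed.

End Special.

(** * Characterization of the extremal sets *)

(** This supplies the generation hypothesis of the bound, as (i) speaks of an arbitrary subset. *)
Lemma diamA_gen A d : diamA_is A d -> <<A>>%g = [set: V].
Proof.
case=> defV _; apply/eqP; rewrite eqEsubset subsetT; apply/subsetP => g _.
by apply: (@sumset_gen _ _ d); rewrite defV inE.
Qed.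

Lemma covers1 A d : covers A 1%g d <-> sumset A d = [set: V].
Proof.
split=> [cov|defV g]; last by exists g; [rewrite defV inE | rewrite subrr; apply: (group1 1%G)].
apply/setP => g; rewrite in_setT; have [s sd] := cov g.
by move/set1gP/eqP; rewrite zmod1gE subr_eq0 => /eqP ->.
Qed.

Lemma std_gen_type_weight m e :
    (forall i, (1 < m i)%N) -> (forall i j : 'I_r, (i <= j)%N -> (m i %| m j)%N) ->
    std_gen m e ->
  type_weight [set: V] 1%g = (\sum_i (m i).-1)%N.
Proof.
move=> m1 mdiv std; rewrite /type_weight.
rewrite -(isog_abelian_type (quotient1_isog [set: V]%G)).
by rewrite (abelian_type_std_gen m1 mdiv std) big_rev big_map big_enum.
Qed.

(** The tower of full height [r] provides the a_i; the quotient by their span has no invariants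
    left, so they generate. *)
Lemma special_form_of_diam m e A :
    (forall i, (1 < m i)%N) -> (forall i j : 'I_r, (i <= j)%N -> (m i %| m j)%N) ->
    std_gen m e -> diamA_is A (\sum_i (m i).-1)%N ->
  exists e' a : 'I_r -> V, std_gen m e' /\ special_form A e' a.
Proof.
move=> m1 mdiv std diamA; have m0 i : (0 < m i)%N by apply: ltnW.
have defT := abelian_type_std_gen m1 mdiv std.
have szT : size (abelian_type [set: V]) = r by rewrite defT size_rev size_map size_enum_ord.
have no_cov d : (d < type_weight [set: V] 1%g)%N -> ~ covers A 1%g d.
  rewrite (std_gen_type_weight m1 mdiv std) => lt_d /covers1 covd.
  by case: diamA => _ /(_ d covd); rewrite leqNgt lt_d.
have [|s [ss sA Ts _ tow]] := max_order_tower (n := r) (diamA_gen diamA) no_cov.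
  by rewrite szT.
pose a (k : 'I_r) := nth 0 s k.
have nthT (i : 'I_r) : nth 0 (abelian_type [set: V]) (r - i.+1) = m i.
  have szm : size (map m (enum 'I_r)) = r by rewrite size_map size_enum_ord.
  have lt_i := ltn_ord i; rewrite defT nth_rev ?szm; last by lia.
  have -> : (r - (r - i.+1).+1 = i)%N by lia.
  by rewrite (nth_map i) ?size_enum_ord // nth_ord_enum.
have rel : forall i, triangular false m a i.
  by apply: (tower_triangular ss m0 mdiv) => i; have := tow i (ltn_ord i); rewrite nthT.
have gen g : exists mu, g = \sum_i a i *+ mu i.
  have defV : seq_span s = [set: V].
    apply/eqP; rewrite eqEsubset subsetT /=.
    have cQ : abelian ([set: V] / seq_span s)%g by apply/quotient_abelian/zmod_abelian.
    have [b defQ] := abelian_structure cQ; rewrite Ts drop_oversize ?szT //.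
    case: b defQ => //; rewrite big_nil => /esym/eqP; rewrite -subG1 quotient_sub1 //.
    exact: (sub_abelian_norm (zmod_abelian [set: V]) (subsetT _)).
  have [|mu _ ->] := @seq_span_drop_sum s 0%N g ss; last by exists mu.
  by rewrite drop0 defV inE.
have aA i : a i \in A by apply/sA/mem_nth; rewrite ss.
have [|defA rel2] := max_length_form m1 mdiv aA gen rel.
  by move=> d lt_d; case: diamA => _ diam /diam; rewrite leqNgt lt_d.
(* The choice e_i = a_i - a_j is killed by m_i because m_i a_i = m_i a_j. *)
have [e' rel'] : exists e' : 'I_r -> V, forall i, e' i *+ m i = 0 /\
    (a i = e' i \/ exists j : 'I_r, (i < j)%N /\ a i = e' i + a j).
  apply: (@fin_all_exists _ (fun=> V) (fun i ei => ei *+ m i = 0 /\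
    (a i = ei \/ exists j : 'I_r, (i < j)%N /\ a i = ei + a j))) => i; case: (rel2 i) => [a0|[j lt_ij eq_a]].
    by exists (a i); split=> //; left.
  exists (a i - a j); split; first by rewrite mulrnBl eq_a subrr.
  by right; exists j; rewrite subrK.
exists e', a; split; last by split=> // i; case: (rel' i).
apply: (std_gen_intro m0 (std_gen_card std) gen) => i; by case: (rel' i).
Qed.

End Coordinates.

Theorem theorem2p2 (G : finZmodType) (r : nat) (m : 'I_r -> nat)
    (Hm1 : forall i : 'I_r, (1 < m i)%N)
    (Hdiv : forall i j : 'I_r, (i <= j)%N -> (m i %| m j)%N)
    (Htype : exists e : 'I_r -> G, std_gen m e)
    (A : {set G}) :
  ((exists d : nat, diamA_is A d /\ diam_is G d) <->
   (exists e a : 'I_r -> G, std_gen m e /\ special_form A e a)) /\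
  (forall e a : 'I_r -> G, std_gen m e -> special_form A e a ->
     forall g : G,
       (exists lam : 'I_r -> nat,
          (forall i, (lam i < m i)%N) /\ g = \sum_(i < r) a i *+ lam i /\
          length_is A g (\sum_(i < r) lam i)%N) /\
       (forall lam mu : 'I_r -> nat,
          (forall i, (lam i < m i)%N) -> (forall i, (mu i < m i)%N) ->
          g = \sum_(i < r) a i *+ lam i -> g = \sum_(i < r) a i *+ mu i ->
          forall i, lam i = mu i)).
Proof.
have [e0 std0] := Htype.
(* The case K = 0 of [type_weight_bound] bounds every diameter. *)
have bound (B : {set G}) d : diamA_is B d -> (d <= \sum_i (m i).-1)%N.
  move=> diamB; have [cov _] := type_weight_bound 1%G (diamA_gen diamB).
  rewrite -(std_gen_type_weight Hm1 Hdiv std0).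
  by case: diamB => _; apply; apply/covers1.
split; last first.
  move=> e a std form g; split; last first.
    move=> lam mu lt_lam lt_mu -> eq_lm.
    exact: (special_form_unique Hm1 std form).
  have [mu ->] := special_form_gen std form g.
  have [lam [lt_lam <- _]] := special_form_reduce Hm1 std form mu.
  by exists lam; do 2!split=> //; apply: (special_form_length Hm1 std form).
split=> [[d [diamA [_ diamG]]]|[e [a [std form]]]].
  (* A standard generating set is itself of the special form, so it attains the bound, which is
     therefore the diameter of G. *)
  have form0 : special_form [set e0 i | i : 'I_r] e0 e0.
    by split=> [|i]; [rewrite /A0 setUC | left].
  have diam0 := special_form_diam Hm1 std0 form0.
  suff def_d : d = (\sum_i (m i).-1)%N.
    by apply: (special_form_of_diam Hm1 Hdiv std0); rewrite -def_d.
  by apply/eqP; rewrite eqn_leq (bound A) // (diamG _ _ (diamA_gen diam0) diam0).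
have diamA := special_form_diam Hm1 std form.
exists (\sum_i (m i).-1)%N; split=> //; split.
  by exists A; split; first exact: diamA_gen diamA.
by move=> B d _; apply: bound.
Qed.
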